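(* Let $n$ be a positive integer. There is an $n$-satisfactory coloring of $K_n$ if and only if $T_n$ tiles a superset of $\mathbb O_n$ in $\mathbb Z^{\pi(n)}$.
   Context: $[n]=\{1,\dots,n\}$. $K_n$ is the set of positive integers all of whose prime factors are less than or equal to $n$. An $n$-satisfactory coloring of $K_n$ is a coloring of $K_n$ using exactly $n$ colors such that for every $a\in K_n$ the numbers $a,2a,\dots,na$ all receive different colors. $\pi(n)$ is the number of primes less than or equal to $n$, and $p_1<\dots<p_{\pi(n)}$ are these primes. $\mathbb O_n=\mathbb N^{\pi(n)}$ (with $0\in\mathbb N$) is the nonnegative orthant of $\mathbb Z^{\pi(n)}$. $T_n$ is the image of $[n]$ under the map $K_n\to\mathbb O_n$ sending $p_1^{\alpha_1}\cdots p_{\pi(n)}^{\alpha_{\pi(n)}}$ to $(\alpha_1,\dots,\alpha_{\pi(n)})$. A set $A\subseteq\mathbb Z^{\pi(n)}$ tiles a set $C\subseteq\mathbb Z^{\pi(n)}$ if there is a set $B\subseteq\mathbb Z^{\pi(n)}$ such that $C=A+B=\{a+b:a\in A,\,b\in B\}$ and every $c\in C$ has a unique representation $c=a+b$ with $a\in A$, $b\in B$. *)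

(* Defs.v *)
From HB Require Import structures.
From mathcomp Require Import all_boot all_order all_algebra.
From mathcomp Require Import boolp classical_sets functions.

Set Implicit Arguments.
Unset Strict Implicit.
Unset Printing Implicit Defensive.

Import Order.TTheory GRing.Theory Num.Theory.

Local Open Scope classical_set_scope.
Local Open Scope ring_scope.

Definition interval1 (n : nat) : set nat := [set a : nat | (1 <= a <= n)%N].

Definition smooth (n : nat) : set nat :=
  [set a : nat | (0 < a)%N /\ forall p : nat, prime p -> (p %| a)%N -> (p <= n)%N].

(* The coloring is a function on nat, but only its values on [smooth n] are
   constrained or used. *)
Definition satisfactory (n : nat) (c : nat -> 'I_n) : Prop :=
  c @` smooth n = [set: 'I_n] /\
  forall a : nat, smooth n a ->
    {in interval1 n &, injective (fun i : nat => c (i * a)%N)}.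

(* In increasing order. *)
Definition primes_upto (n : nat) : seq nat := [seq p <- iota 1 n | prime p].

Definition prime_count (n : nat) : nat := size (primes_upto n).

Definition exponents (n a : nat) : 'rV[int]_(prime_count n) :=
  \row_(i < prime_count n) (logn (tnth (in_tuple (primes_upto n)) i) a)%:Z.

Definition orthant (n : nat) : set 'rV[int]_(prime_count n) :=
  [set v | forall i : 'I_(prime_count n), 0 <= v 0 i].
Arguments orthant n : clear implicits.

Definition exponent_tile (n : nat) : set 'rV[int]_(prime_count n) :=
  exponents n @` interval1 n.
Arguments exponent_tile n : clear implicits.

Definition tiles (V : zmodType) (A C : set V) : Prop :=
  exists B : set V,
    C = [set a + b | a in A & b in B] /\
    forall c : V, C c ->
      exists! ab : V * V, [/\ A ab.1, B ab.2 & c = ab.1 + ab.2].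

(* Main.v *)
Require Import Defs.
From mathcomp Require Import all_boot all_order all_algebra.
From mathcomp Require Import boolp classical_sets functions.
From mathcomp Require Import filter.

(** A satisfactory coloring pulls back to a coloring of the orthant in which the
    [n] points of every translate [w + T], [w] in the orthant, have different
    colors, so that each color occurs exactly once in each translate.

    From a tiling to a coloring: if [v = t + b] with [t] in [T] and [b] in the
    translation set, color [v] by [t].  When [w + t1 = t + b1] and
    [w + t2 = t + b2] have the same color, subtracting gives
    [t2 + b1 = t1 + b2], a point of the tiled set with two decompositions unless
    [t1 = t2] ([shifts_same_color_eq]).

    From a coloring to a tiling: let [L] be a color class.  Every [w] in the
    orthant is uniquely of the form [l - t], so it is [-T], not [T], that tiles
    here, and only as far as the orthant goes.  Reflecting through a far away
    corner, [v |-> (N, ..., N) - v], repairs the sign: the reflections of [L]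
    are translation sets for [T] on regions that exhaust the whole lattice as
    [N] grows.  Compactness provides a limit of these sets; it is taken along a
    nonprincipal ultrafilter on the indices [N] ([reflection_limit]).
    Decompositions stay unique in the limit, and they continue to exist because
    [T] is finite, so the limit set tiles all of the lattice. *)

Local Open Scope classical_set_scope.
Local Open Scope ring_scope.

Import Order.TTheory GRing.Theory Num.Theory.

Set Implicit Arguments.
Unset Strict Implicit.
Unset Printing Implicit Defensive.

(** * Smooth numbers as points of the orthant *)

Lemma logn_prod (I : Type) (r : seq I) (F : I -> nat) (p : nat) :
  (forall i, 0 < F i)%N ->
  logn p (\prod_(i <- r) F i)%N = (\sum_(i <- r) logn p (F i))%N.
Proof.
move=> F_gt0.
pose K (m s : nat) := (0 < m)%N /\ logn p m = s.
suff [] : K (\prod_(i <- r) F i)%N (\sum_(i <- r) logn p (F i))%N by [].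
apply: (big_ind2 K) => [|m1 s1 m2 s2 [m1_gt0 <-] [m2_gt0 <-]|i _].
- by split; rewrite ?logn1.
- by split; rewrite ?muln_gt0 ?m1_gt0 ?lognM.
- by split; first exact: F_gt0.
Qed.

Lemma smoothM (n a b : nat) : smooth n a -> smooth n b -> smooth n (a * b)%N.
Proof.
move=> [a_gt0 a_le] [b_gt0 b_le]; split; first by rewrite muln_gt0 a_gt0.
by move=> p p_pr; rewrite Euclid_dvdM // => /orP[/a_le|/b_le]; apply.
Qed.

Lemma interval1_smooth (n a : nat) : interval1 n a -> smooth n a.
Proof.
move=> /andP[a_gt0 a_le]; split=> // p _ /dvdn_leq.
by move=> /(_ a_gt0) /leq_trans; apply.
Qed.

Definition prime_at (n : nat) (i : 'I_(prime_count n)) : nat :=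
  tnth (in_tuple (primes_upto n)) i.

Lemma mem_primes_upto (n p : nat) :
  (p \in primes_upto n) = prime p && (p <= n)%N.
Proof.
rewrite mem_filter mem_iota add1n ltnS.
by case p_pr: (prime p) => //=; rewrite prime_gt0.
Qed.

Lemma prime_atP (n : nat) (i : 'I_(prime_count n)) :
  prime (prime_at i) /\ (prime_at i <= n)%N.
Proof. by apply/andP; rewrite -mem_primes_upto mem_tnth. Qed.

Lemma prime_at_inj (n : nat) : injective (@prime_at n).
Proof.
by apply/tuple_uniqP; rewrite filter_uniq // iota_uniq.
Qed.

Lemma prime_at_onto (n p : nat) :
  prime p -> (p <= n)%N -> exists i : 'I_(prime_count n), p = prime_at i.
Proof.
move=> p_pr p_le.
have : p \in in_tuple (primes_upto n) by rewrite /= mem_primes_upto p_pr.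
by move=> /tnthP.
Qed.

Lemma exponentsM (n a b : nat) : (0 < a)%N -> (0 < b)%N ->
  exponents n (a * b) = exponents n a + exponents n b.
Proof.
by move=> a_gt0 b_gt0; apply/rowP => i; rewrite !mxE lognM // PoszD.
Qed.

Lemma exponents_orthant (n a : nat) : orthant n (exponents n a).
Proof. by move=> i; rewrite mxE. Qed.

Lemma exponents_inj (n a b : nat) : smooth n a -> smooth n b ->
  exponents n a = exponents n b -> a = b.
Proof.
move=> [a_gt0 a_le] [b_gt0 b_le] eq_ab; apply: eqn_from_log => // p.
have logn0 c : (0 < c)%N ->
    (forall q, prime q -> (q %| c)%N -> (q <= n)%N) ->
    ~~ (prime p && (p <= n)%N) -> logn p c = 0%N.
  move=> c_gt0 c_le; rewrite lognE c_gt0 andTb; case: ifP => //.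
  by move=> /andP[p_pr p_c]; rewrite p_pr c_le.
have [/andP[p_pr p_le]|p_big] := boolP (prime p && (p <= n)%N); last first.
  by rewrite !logn0.
have [i ->] := prime_at_onto p_pr p_le.
by have /rowP/(_ i) := eq_ab; rewrite !mxE => - [].
Qed.

Definition number_of (n : nat) (v : 'rV[int]_(prime_count n)) : nat :=
  (\prod_(i < prime_count n) prime_at i ^ `|v 0%R i|)%N.

Lemma number_of_smooth (n : nat) (v : 'rV[int]_(prime_count n)) :
  smooth n (number_of v).
Proof.
split.
  by apply: prodn_gt0 => i; rewrite expn_gt0 prime_gt0 ?(prime_atP i).1.
move=> p p_pr; rewrite Euclid_dvd_prod // big_has => /hasP[i _].
have [q_pr q_le] := prime_atP i.
by rewrite Euclid_dvdX // dvdn_prime2 // => /andP[/eqP-> _].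
Qed.

Lemma number_ofK (n : nat) (v : 'rV[int]_(prime_count n)) :
  orthant n v -> exponents n (number_of v) = v.
Proof.
move=> v_ge0; apply/rowP => i; rewrite mxE -[LHS]/((logn (prime_at i) _)%:Z).
rewrite logn_prod => [|j]; last by rewrite expn_gt0 prime_gt0 ?(prime_atP j).1.
rewrite (bigD1 i) //= big1 => [|j j_neq_i].
  by rewrite addn0 lognX logn_prime ?(prime_atP i).1 // eqxx muln1 gez0_abs.
rewrite lognX logn_prime ?(prime_atP j).1 // (inj_eq (@prime_at_inj n)).
by rewrite eq_sym (negPf j_neq_i) muln0.
Qed.

Lemma number_of_shift (n a : nat) (v : 'rV[int]_(prime_count n)) :
  interval1 n a -> orthant n v ->
  number_of (v + exponents n a) = (a * number_of v)%N.
Proof.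
move=> a_int v_ge0; have a_sm := interval1_smooth a_int.
apply: (@exponents_inj n); first exact: number_of_smooth.
  by apply: smoothM => //; exact: number_of_smooth.
rewrite number_ofK; last first.
  by move=> i; rewrite mxE addr_ge0 //; exact: exponents_orthant.
rewrite exponentsM ?a_sm.1 ?(number_of_smooth v).1 //.
by rewrite number_ofK // addrC.
Qed.

Lemma interval1S (n : nat) (i : 'I_n) : interval1 n i.+1.
Proof. exact: ltn_ord. Qed.

Lemma interval1P (n a : nat) :
  interval1 n a -> exists i : 'I_n, a = i.+1.
Proof. by case: a => [|a] // a_lt; exists (Ordinal (a_lt : (a < n)%N)). Qed.

(** * Tilings by the exponent vectors *)

Definition tile_point (n : nat) (i : 'I_n) : 'rV[int]_(prime_count n) :=
  exponents n i.+1.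

Lemma tile_point_inj (n : nat) : injective (@tile_point n).
Proof.
move=> i j eq_ij; apply: val_inj; apply: succn_inj.
by apply: exponents_inj eq_ij; exact: interval1_smooth (interval1S _).
Qed.

Lemma exponent_tileP (n : nat) (v : 'rV[int]_(prime_count n)) :
  exponent_tile n v <-> exists i : 'I_n, v = tile_point i.
Proof.
split=> [[a /interval1P[i ->] <-]|[i ->]]; first by exists i.
by exists i.+1 => //; exact: interval1S.
Qed.

(** The step from a tiling to a coloring: the two equations
    [w + t i = t k + b] and [w + t j = t k + b'] combine to
    [t j + b = t i + b'], two decompositions of one point. *)
Lemma shifts_same_color_eq (n : nat) (C B : set 'rV[int]_(prime_count n))
    (w : 'rV[int]_(prime_count n)) (i j k : 'I_n) :
  C = [set a + b | a in exponent_tile n & b in B] ->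
  (forall c, C c ->
     exists! ab : 'rV[int]_(prime_count n) * 'rV[int]_(prime_count n),
       [/\ exponent_tile n ab.1, B ab.2 & c = ab.1 + ab.2]) ->
  B (w + tile_point i - tile_point k) -> B (w + tile_point j - tile_point k) ->
  i = j.
Proof.
move=> C_sum C_uniq Bi Bj.
have T l : exponent_tile n (tile_point l) by apply/exponent_tileP; exists l.
set bi := w + _ - _ in Bi; set bj := w + _ - _ in Bj.
have eq_c : tile_point j + bi = tile_point i + bj.
  rewrite /bi /bj !addrA; congr (_ - _).
  by rewrite addrAC [RHS]addrAC [tile_point j + _]addrC.
have [|ab [_ uniq_ab]] := C_uniq (tile_point j + bi).
  by rewrite C_sum; exists (tile_point j) => //; exists bi.
have eq_j := uniq_ab (tile_point j, bi) (And3 (T j) Bi erefl).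
have eq_i := uniq_ab (tile_point i, bj) (And3 (T i) Bj eq_c).
by apply: tile_point_inj; have [] := etrans (esym eq_i) eq_j.
Qed.

Lemma tiling_to_coloring (n : nat) (C : set 'rV[int]_(prime_count n)) :
  (0 < n)%N -> orthant n `<=` C -> tiles (exponent_tile n) C ->
  exists c : nat -> 'I_n, satisfactory c.
Proof.
move=> n_gt0 sub_C [B [C_sum C_uniq]].
have /choice[c cP] : forall a, exists k : 'I_n,
    B (exponents n a - tile_point k).
  move=> a; have : C (exponents n a) by apply/sub_C/exponents_orthant.
  rewrite C_sum => - [_ /exponent_tileP[k ->] [b Bb eq_a]]; exists k.
  by rewrite -eq_a addrC addKr.
have c_inj a : smooth n a -> injective (fun i : 'I_n => c (i.+1 * a)%N).
  move=> [a_gt0 _] i j eq_c.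
  have Bc l : B (exponents n a + tile_point l - tile_point (c (l.+1 * a)%N)).
    by have := cP (l.+1 * a)%N; rewrite exponentsM // [_ + exponents n a]addrC.
  have := Bc j; rewrite -eq_c.
  exact: (shifts_same_color_eq C_sum C_uniq (Bc i)).
exists c; split; last first.
  move=> a a_sm x y; rewrite !inE => /interval1P[i ->] /interval1P[j ->].
  by move=> /(c_inj a a_sm) ->.
have one_sm : smooth n 1%N by apply: interval1_smooth; exact: n_gt0.
(* The multiples of 1 already use [n] different colors. *)
apply/seteqP; split=> // k _.
have /codomP[i ->] := injF_onto (c_inj _ one_sm) k.
by exists (i.+1 * 1)%N => //; rewrite muln1; exact: interval1_smooth (interval1S i).
Qed.

(** * Reflecting a color class and passing to the limit *)

(** Here [B] is the limit, along an ultrafilter, of the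
    reflections [(N, ..., N) - P].  For fixed [x] and large [N] the point
    [(N, ..., N) - x] lies in the orthant, hence the hypothesis singles out one
    index [i_N]; there are finitely many indices, so the ultrafilter selects
    one of them. *)
Lemma reflection_limit (d n : nat) (t : 'I_n -> 'rV[int]_d)
    (P : set 'rV[int]_d) :
  (forall w : 'rV[int]_d, (forall i, 0 <= w 0 i) ->
     exists! k : 'I_n, P (w + t k)) ->
  exists B : set 'rV[int]_d, forall x, exists! k : 'I_n, B (x - t k).
Proof.
move=> P_uniq.
have [U [U_ultra sub_U]] := ultraFilterLemma eventually_filter.
pose refl (N : nat) (v : 'rV[int]_d) : 'rV[int]_d := const_mx N%:Z - v.
exists [set v | U [set N | P (refl N v)]] => x.
have far : U [set N | exists! k, P (refl N (x - t k))].
  apply: sub_U; exists (\sum_(i < d) `|x 0%R i|)%N => // N /= le_N.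
  have [i|k [Pk uniq_k]] := P_uniq (const_mx N%:Z - x).
    rewrite !mxE subr_ge0; apply: (le_trans (ler_norm _)).
    rewrite -abszE lez_nat; apply: leq_trans le_N.
    by rewrite (bigD1 i) //= leq_addr.
  have reflE l : refl N (x - t l) = const_mx N%:Z - x + t l.
    by rewrite /refl opprB addrA addrAC.
  by exists k; split=> [|l]; rewrite reflE //; exact: uniq_k.
have [k Uk] : exists k, U [set N | P (refl N (x - t k))].
  apply: contrapT => none.
  have notU k : U (~` [set N | P (refl N (x - t k))]).
    by have [Uk|//] := in_ultra_setVsetC [set N | P (refl N (x - t k))] U_ultra;
      case: none; exists k.
  have [N [[k [Pk _]] noP]] := filter_ex (filterI far (filter_forall _ notU)).
  exact: noP k Pk.
exists k; split=> // l Ul.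
have [N [[j [_ uniq_j]] [Pk Pl]]] := filter_ex (filterI far (filterI Uk Ul)).
by rewrite -(uniq_j k Pk) -(uniq_j l Pl).
Qed.

Lemma coloring_to_tiling (n : nat) (c : nat -> 'I_n) :
  (0 < n)%N -> satisfactory c -> tiles (exponent_tile n) setT.
Proof.
move=> n_gt0 [_ c_inj]; pose k0 := Ordinal n_gt0.
have [w w_ge0|B B_uniq] :=
  @reflection_limit _ _ (@tile_point n) [set v | c (number_of v) = k0].
  have f_inj : injective (fun i : 'I_n => c (i.+1 * number_of w)%N).
    move=> i j eq_c; apply: val_inj; apply: succn_inj.
    apply: (c_inj _ (number_of_smooth w)); rewrite ?inE //; exact: interval1S.
  have /codomP[i eq_k0] := injF_onto f_inj k0.
  have shiftE j : number_of (w + tile_point j) = (j.+1 * number_of w)%N.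
    by apply: number_of_shift => //; exact: interval1S.
  exists i; split=> [|j]; rewrite /= shiftE // eq_k0.
  by move=> /f_inj.
exists B; split.
  apply/seteqP; split=> // x _; have [k [Bk _]] := B_uniq x.
  exists (tile_point k); first by apply/exponent_tileP; exists k.
  by exists (x - tile_point k) => //; rewrite addrC subrK.
move=> x _; have [k [Bk uniq_k]] := B_uniq x.
exists (tile_point k, x - tile_point k); split.
  by split=> //=; [apply/exponent_tileP; exists k | rewrite addrC subrK].
move=> [a b] [/= /exponent_tileP[l ->] Bb eq_x].
have b_eq : b = x - tile_point l by rewrite eq_x addrC addKr.
by rewrite b_eq (uniq_k l) // -b_eq.
Qed.

Theorem theorem1p13 (n : nat) (hn : (0 < n)%N) :
  (exists c : nat -> 'I_n, satisfactory c) <->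
  (exists C : set 'rV[int]_(prime_count n),
     orthant n `<=` C /\ tiles (exponent_tile n) C).
Proof.
split=> [[c c_sat]|[C [sub_C C_tiles]]].
  by exists setT; split=> //; exact: (coloring_to_tiling hn c_sat).
exact: (tiling_to_coloring hn sub_C C_tiles).
Qed.
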